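(* Let $p\in[1,\infty]$ and $q$ its dual exponent ($1/p+1/q=1$). Let $\boldsymbol{\mu}_+,\boldsymbol{\mu}_-\in\mathbb{R}^d$, $\sigma>0$, and let $(\boldsymbol{X},Y)$ be random with $P(Y=+)=P(Y=-)=1/2$ and $\boldsymbol{X}\mid Y=i\sim N(\boldsymbol{\mu}_i,\sigma^2\boldsymbol{I}_d)$. Let $\boldsymbol{w}\in\mathbb{R}^d\setminus\{\boldsymbol{0}\}$, $b\in\mathbb{R}$, and let the linear classifier assign $\boldsymbol{x}$ to class $+$ iff $\boldsymbol{w}\cdot\boldsymbol{x}+b>0$. Let $\varepsilon>0$, $\boldsymbol{\mu}=\frac12(\boldsymbol{\mu}_+-\boldsymbol{\mu}_-)$, $\bar{\boldsymbol{\mu}}=\frac12(\boldsymbol{\mu}_++\boldsymbol{\mu}_-)$, $b'=\boldsymbol{w}\cdot\bar{\boldsymbol{\mu}}+b$. Let $p_m$ be the probability that $\boldsymbol{X}$ is misclassified and $p_{adv|p}$ the probability that $\boldsymbol{X}$ is correctly classified and there is $\boldsymbol{x}'$ with $\|\boldsymbol{X}-\boldsymbol{x}'\|_p\le\varepsilon$ that is assigned a different class than $\boldsymbol{X}$. Then $$p_{adv|p}=1-p_m-\frac12\left[\Phi\!\left(\frac{\boldsymbol{w}\cdot\boldsymbol{\mu}+b'}{\|\boldsymbol{w}\|_2\sigma}-\frac{\|\boldsymbol{w}\|_q}{\|\boldsymbol{w}\|_2}\frac{\varepsilon}{\sigma}\right)+\Phi\!\left(\frac{\boldsymbol{w}\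cdot\boldsymbol{\mu}-b'}{\|\boldsymbol{w}\|_2\sigma}-\frac{\|\boldsymbol{w}\|_q}{\|\boldsymbol{w}\|_2}\frac{\varepsilon}{\sigma}\right)\right].$$
   Context: $\Phi$ denotes the standard normal CDF. *)

(* Defs.v *)
From HB Require Import structures.
From mathcomp Require Import all_boot all_order all_algebra.
From mathcomp Require Import all_classical all_reals all_analysis.
Set Implicit Arguments. Unset Strict Implicit. Unset Printing Implicit Defensive.
Import Order.TTheory GRing.Theory Num.Theory.
Local Open Scope classical_set_scope.
Local Open Scope ring_scope.

Section defs.
Context {R : realType} {d : nat}.

Definition dotp (v x : 'I_d -> R) : R := \sum_(i < d) v i * x i.

(* l^p norm for p in [1, +oo] (p an extended real);
   p = +oo gives the max norm. (-oo is never used; value 0 there.) *)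
Definition lpnorm (p : \bar R) (v : 'I_d -> R) : R :=
  match p with
  | +oo%E => \big[Num.max/0]_(i < d) `|v i|
  | r%:E => (\sum_(i < d) `|v i| `^ r) `^ r^-1
  | -oo%E => 0
  end.

Definition classify (w : 'I_d -> R) (b : R) (x : 'I_d -> R) : bool :=
  0 < dotp w x + b.

End defs.

Definition dual_exponent {R : realType} (p q : \bar R) : Prop :=
  (p = 1%E /\ q = +oo%E) \/ (p = +oo%E /\ q = 1%E) \/
  exists r s : R, p = r%:E /\ q = s%:E /\ 1 < r /\ 1 < s /\ r^-1 + s^-1 = 1.

Definition Phi {R : realType} (x : R) : R :=
  fine (normal_prob 0 1 `]-oo, x]).

(* Main.v *)
Require Import Defs.
From HB Require Import structures.
From mathcomp Require Import all_boot all_order all_algebra.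
From mathcomp Require Import all_classical all_reals all_analysis.
From mathcomp Require Import measurable_realfun ring lra.
Import Order.TTheory GRing.Theory Num.Theory.
Local Open Scope classical_set_scope.
Local Open Scope ring_scope.

(** By Hölder's inequality and its equality case, the values of [dotp w] on the
    closed l^p ball of radius [eps] around [x] range over the interval of
    half-width [eps * lpnorm q w] around [dotp w x], endpoints included.  Hence
    [x] is correctly classified with no adversarial example iff its signed
    margin [dotp w x + b] exceeds [eps * lpnorm q w] on class +, or is at most
    the opposite of it on class -.  Given the class, [dotp w X] is normal with
    standard deviation [lpnorm 2 w * sigma], which gives the probability of this
    robust event; together with misclassification it is the complement of the
    adversarial event.  Normality of [dotp w X] is obtained by adding the
    coordinates one at a time, each step being a convolution of two normal
    laws. *)

(** * Integration against a measure given by a nonnegative density *)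

Section density.
Local Open Scope ereal_scope.
Import HBNNSimple.

(** For an indicator [f] this is the hypothesis [nuE]. Linearity extends it to nonnegative simple
    functions, and monotone convergence, applied on both sides to [nnsfun_approx], to every
    nonnegative measurable [f]. *)
Lemma ge0_integral_density (d : measure_display) (T : measurableType d)
    (R : realType) (mu nu : {measure set T -> \bar R}) (g : T -> R) :
  measurable_fun setT g -> (forall x, 0 <= g x)%R ->
  (forall A, measurable A -> nu A = \int[mu]_(x in A) (g x)%:E) ->
  forall f : T -> \bar R, measurable_fun setT f -> (forall x, 0 <= f x) ->
  \int[nu]_x f x = \int[mu]_x (f x * (g x)%:E).
Proof.
move=> mg g0 nuE f mf f0.
have mEg : measurable_fun setT (EFin \o g) by exact/measurable_EFinP.
have indicE_ E : measurable E ->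
    \int[nu]_x (\1_E x)%:E = \int[mu]_x ((\1_E x)%:E * (g x)%:E).
  move=> mE; rewrite integral_indic// setIT nuE// integral_mkcond.
  apply: eq_integral => x _; rewrite patchE indicE.
  by case: (x \in E); rewrite ?mul1e ?mul0e.
have nnsfunE (h : {nnsfun T >-> R}) :
    \int[nu]_x (h x)%:E = \int[mu]_x ((h x)%:E * (g x)%:E).
  under [LHS]eq_integral do rewrite fimfunE -fsumEFin//.
  rewrite ge0_integral_fsum//; last 2 first.
    - by move=> r; exact/measurable_EFinP/measurableT_comp.
    - by move=> r x _; rewrite EFinM nnfun_muleindic_ge0.
  under [RHS]eq_integral => x _.
    rewrite fimfunE -fsumEFin// ge0_mule_fsuml; last first.
      by move=> y; exact: nnfun_muleindic_ge0.
    over.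
  rewrite ge0_integral_fsum//; last 2 first.
    - move=> r; apply: emeasurable_funM => //.
      exact/measurable_EFinP/measurableT_comp.
    - by move=> r x _; apply: mule_ge0; [exact: nnfun_muleindic_ge0|rewrite lee_fin].
  apply: eq_fsbigr => r _.
  rewrite integralZl_indic_nnsfun//= indicE_//.
  have [r0|r0] := leP 0%R r.
    rewrite -ge0_integralZl//; last 2 first.
      - apply: emeasurable_funM => //.
        exact/measurable_EFinP/measurable_indic.
      - by move=> x _; rewrite mule_ge0 ?lee_fin.
    by apply: eq_integral => x _; rewrite EFinM muleA.
  (* For [r < 0] the level set of the nonnegative simple function is empty, so both sides vanish. *)
  rewrite preimage_nnfun0//.
  under eq_integral do rewrite indicE in_set0 mul0e.
  under [RHS]eq_integral do rewrite indicE in_set0 mulr0 mul0e.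
  by rewrite integral0 mule0.
pose f_ := nnsfun_approx measurableT mf.
transitivity (limn (fun n => \int[nu]_x (f_ n x)%:E)).
  rewrite -monotone_convergence//=.
  - apply: eq_integral => x _; apply/esym/cvg_lim => //=.
    exact: cvg_nnsfun_approx.
  - by move=> n; exact/measurable_EFinP.
  - by move=> n x _; rewrite lee_fin.
  - by move=> x _ a b ab; rewrite lee_fin//; exact/lefP/nd_nnsfun_approx.
transitivity (limn (fun n => \int[mu]_x ((f_ n x)%:E * (g x)%:E))).
  by congr (limn _); apply/funext => n; exact: nnsfunE.
rewrite -monotone_convergence//=.
- apply: eq_integral => x _; apply/cvg_lim => //=.
  by apply: cvgeZr => //; exact: cvg_nnsfun_approx.
- by move=> n; apply: emeasurable_funM => //; exact/measurable_EFinP.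
- by move=> n x _; rewrite mule_ge0 ?lee_fin.
- move=> x _ a b ab; apply: lee_wpmul2r; rewrite lee_fin//.
  exact/lefP/nd_nnsfun_approx.
Qed.
End density.

(** * Affine changes of variable for Lebesgue measure and normal laws *)

Definition pushforward_measure {d1 d2 : measure_display}
    {T1 : measurableType d1} {T2 : measurableType d2} {R : realType}
    (m : {measure set T1 -> \bar R}) {f : T1 -> T2}
    (mf : measurable_fun setT f) : {measure set T2 -> \bar R} :=
  measure_function_pushforward__canonical__measure_function_Measure m mf.

Lemma measurable_affine (R : realType) (a c : R) :
  measurable_fun setT (fun x : R => a * x + c).
Proof.
by apply: measurable_funD => //; apply: measurable_funM.
Qed.

Lemma measurable_affine_preimage (R : realType) (a c : R) (B : set R) :
  measurable B -> measurable ((fun x : R => a * x + c) @^-1` B).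
Proof.
by move=> mB; rewrite -[X in measurable X]setTI; exact: measurable_affine.
Qed.

Section affine.
Local Open Scope ereal_scope.
Variable R : realType.
Local Notation leb := (@lebesgue_measure R).

(** The right-hand side is a measure in [A], a scaled pushforward, so by uniqueness of Lebesgue
    measure it suffices to compare lengths of left-open right-closed intervals. *)
Lemma lebesgue_measure_affine (a c : R) (A : set R) : a != 0%R ->
  measurable A ->
  leb A = `|a|%:E * leb ((fun x : R => a * x + c)%R @^-1` A).
Proof.
move=> a0 mA.
pose f := (fun x : R => a * x + c)%R : measurableTypeR R -> measurableTypeR R.
have mf : measurable_fun setT f by exact: measurable_affine.
have an : (0 <= `|a|)%R by [].
pose m : {measure set (measurableTypeR R) -> \bar R} :=
  mscale (NngNum an) (pushforward_measure leb mf).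
rewrite -[RHS]/(m A).
apply: lebesgue_measure_unique => // _ [[u v] _ <-] /=.
rewrite /m /mscale /pushforward /=.
have /orP[alt0|agt0] : (a < 0)%R || (0 < a)%R by rewrite -neq_lt.
(* A negative slope reverses the interval, so the closed end moves to the left; the length is
   unaffected. *)
- rewrite [X in _ * lebesgue_measure X](_ : _ =
      [set` `[((v - c) / a)%R, ((u - c) / a)%R[]); last first.
    apply/seteqP; split => x /=; rewrite !in_itv/= ltr_ndivlMr// ler_ndivrMr//.
      by rewrite /f mulrC => /andP[? ?]; apply/andP; split; lra.
    by rewrite /f mulrC => /andP[? ?]; apply/andP; split; lra.
  rewrite !lebesgue_measure_itv/= !lte_fin ltr_nM2r ?invr_lt0// ltrD2r.
  case: ifP => _; last by rewrite mule0.
  by rewrite -!EFinD -EFinM ltr0_norm//; congr EFin; field; exact: ltr0_neq0.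
- rewrite [X in _ * lebesgue_measure X](_ : _ =
      [set` `]((u - c) / a)%R, ((v - c) / a)%R]]); last first.
    apply/seteqP; split => x /=; rewrite !in_itv/= ltr_pdivrMr// ler_pdivlMr//.
      by rewrite /f mulrC => /andP[? ?]; apply/andP; split; lra.
    by rewrite /f mulrC => /andP[? ?]; apply/andP; split; lra.
  rewrite !lebesgue_measure_itv/= !lte_fin ltr_pM2r ?invr_gt0// ltrD2r.
  case: ifP => _; last by rewrite mule0.
  by rewrite -!EFinD -EFinM gtr0_norm//; congr EFin; field; exact: lt0r_neq0.
Qed.

Lemma ge0_integral_affine (a c : R) (f : R -> \bar R) : a != 0%R ->
  measurable_fun setT f -> (forall x, 0 <= f x) ->
  \int[leb]_x f x = `|a|%:E * \int[leb]_x f (a * x + c)%R.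
Proof.
move=> a0 mf f0.
pose g := (fun x : R => a * x + c)%R : measurableTypeR R -> measurableTypeR R.
have mg : measurable_fun setT g by exact: measurable_affine.
have an : (0 <= `|a|)%R by [].
pose m : {measure set (measurableTypeR R) -> \bar R} :=
  mscale (NngNum an) (pushforward_measure leb mg).
rewrite (eq_measure_integral m); last first.
  by move=> A mA _; exact: lebesgue_measure_affine.
rewrite ge0_integral_mscale//=.
by rewrite ge0_integral_pushforward.
Qed.

(** After the change of variable, the Jacobian (the absolute value of [a]) cancels against the peak
    of the density with parameter [a * s]. That parameter may be negative: the density sees only its
    square. *)
Lemma normal_prob_affine (a c m s : R) (B : set R) : a != 0%R -> s != 0%R ->
  measurable B ->
  normal_prob m s ((fun x : R => a * x + c)%R @^-1` B) =
  normal_prob (a * m + c) (a * s) B.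
Proof.
move=> a0 s0 mB; rewrite /normal_prob [RHS]integral_mkcond [LHS]integral_mkcond.
pose h := (fun x : R => (normal_pdf (a * m + c) (a * s) x)%:E) \_ B.
have mh : measurable_fun setT h.
  apply: (proj1 (measurable_restrictT
    (fun x : R => (normal_pdf (a * m + c) (a * s) x)%:E) mB)).
  apply/measurable_EFinP.
  by apply: measurable_funTS; exact: measurable_normal_pdf.
have h0 x : 0 <= h x.
  by rewrite /h patchE; case: ifP => // _; rewrite lee_fin normal_pdf_ge0.
rewrite -/h [RHS](@ge0_integral_affine a c)// -ge0_integralZl//; last first.
  exact: measurableT_comp mh (measurable_affine _ _ _).
apply: eq_integral => x _; rewrite /h !patchE.
have -> : (x \in (fun x => a * x + c)%R @^-1` B) = (a * x + c \in B)%R.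
  by apply/idP/idP; rewrite !inE.
case: ifP => _; last by rewrite mule0.
rewrite -EFinM !normal_pdfE ?mulf_neq0//; congr EFin.
rewrite /normal_peak /normal_fun mulrA; congr (_ * expR _)%R.
  have -> : (Num.sqrt ((a * s) ^+ 2 * pi *+ 2) =
             `|a| * Num.sqrt (s ^+ 2 * pi *+ 2))%R.
    by rewrite -(sqrtr_sqr a) -sqrtrM ?sqr_ge0//; congr Num.sqrt; ring.
  by rewrite invfM mulrA divff ?mul1r ?normr_eq0.
by field; rewrite a0 s0.
Qed.
End affine.

(* Completing the square: the second factor is, for fixed [z], a normal density
   in [x], so that integrating over [x] leaves the convolved density. *)
Lemma normal_pdfM (R : realType) (m1 m2 s1 s2 s x z : R) :
  s1 != 0 -> s2 != 0 -> s != 0 -> s ^+ 2 = s1 ^+ 2 + s2 ^+ 2 ->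
  normal_pdf (m2 + x) s2 z * normal_pdf m1 s1 x =
  normal_pdf (m1 + m2) s z *
  normal_pdf ((m1 * s2 ^+ 2 + (z - m2) * s1 ^+ 2) / s ^+ 2) (s1 * s2 / s) x.
Proof.
move=> s10 s20 s0 ss; have ss0 : s1 ^+ 2 + s2 ^+ 2 != 0 by rewrite -ss sqrf_eq0.
rewrite !normal_pdfE ?mulf_neq0 ?invr_eq0// /normal_peak /normal_fun.
rewrite !(mulrACA _ (expR _)) -!expRD -!invfM -!sqrtrM; last 2 first.
- by rewrite mulrn_wge0// mulr_ge0 ?sqr_ge0// pi_ge0.
- by rewrite mulrn_wge0// mulr_ge0 ?sqr_ge0// pi_ge0.
congr ((Num.sqrt _)^-1 * expR _); first by field.
by rewrite [(_ / s) ^+ 2]exprMn exprVn !ss; field; rewrite ss0 s10 s20.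
Qed.

(** * Convolution of two normal laws *)

Section convolution.
Local Open Scope ereal_scope.
Variable R : realType.
Local Notation leb := (@lebesgue_measure R).

(** The section of the event at [x] has the mass that a normal law shifted by [x] gives to [B].
    Writing everything with densities and exchanging the integrals leaves, by [normal_pdfM], a
    normal density in [x] to integrate out. *)
Lemma normal_prob_convolution (m1 m2 s1 s2 s : R) (B : set R) :
  s1 != 0%R -> s2 != 0%R -> s != 0%R -> (s ^+ 2 = s1 ^+ 2 + s2 ^+ 2)%R ->
  measurable B ->
  (normal_prob m1 s1 \x normal_prob m2 s2)
    ((fun z : R * R => z.1 + z.2)%R @^-1` B) = normal_prob (m1 + m2) s B.
Proof.
move=> s10 s20 s0 ss mB.
have madd : measurable_fun setT (fun z : R * R => z.1 + z.2)%R.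
  by apply: measurable_funD.
have mD : measurable ((fun z : R * R => z.1 + z.2)%R @^-1` B).
  by rewrite -[X in measurable X]setTI; exact: madd.
have secE x : normal_prob m2 s2
    (xsection ((fun z : R * R => z.1 + z.2)%R @^-1` B) x) =
    normal_prob (m2 + x) s2 B.
  rewrite -[m2 in RHS]mul1r -[s2 in RHS]mul1r -normal_prob_affine ?oner_eq0//.
  congr normal_prob; apply/seteqP; split=> y;
    by rewrite /xsection /= inE/= mul1r addrC.
rewrite /product_measure1 /=.
rewrite (@ge0_integral_density _ _ _ leb _ (normal_pdf m1 s1)
  (measurable_normal_pdf _ _) (normal_pdf_ge0 _ _))//; last first.
  exact: (@measurable_fun_xsection _ _ _ _ _ (normal_prob m2 s2)).
(* The joint density of the first summand [z.1] and the total [z.2], cut off to totals in [B]. *)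
pose f (z : R * R) : \bar R :=
  (normal_pdf m2 s2 (z.2 - z.1) * normal_pdf m1 s1 z.1 * \1_B z.2)%:E.
have pdfB x z : normal_pdf (m2 + x) s2 z = normal_pdf m2 s2 (z - x).
  by rewrite !normal_pdfE// /normal_fun [(m2 + x)%R]addrC opprD addrA.
have fE x z : f (x, z) = (normal_pdf (m1 + m2) s z * \1_B z)%:E *
    (normal_pdf ((m1 * s2 ^+ 2 + (z - m2) * s1 ^+ 2) / s ^+ 2)
       (s1 * s2 / s) x)%:E.
  by rewrite -EFinM mulrAC -normal_pdfM// pdfB.
have f0 z : 0 <= f z by rewrite lee_fin !mulr_ge0 ?normal_pdf_ge0.
have mf : measurable_fun setT f.
  apply/measurable_EFinP; apply: measurable_funM; last first.
    by apply: measurableT_comp => //; exact: measurable_indic.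
  apply: measurable_funM; last first.
    exact: measurableT_comp (measurable_normal_pdf _ _) measurable_fst.
  apply: (measurableT_comp (measurable_normal_pdf _ _)).
  by apply: measurable_funB.
transitivity (\int[leb]_x \int[leb]_z f (x, z)).
  apply: eq_integral => x _; rewrite secE /normal_prob.
  rewrite integral_mkcond -ge0_integralZr//; last 3 first.
  - apply: (proj1 (measurable_restrictT
        (fun z : R => (normal_pdf (m2 + x) s2 z)%:E) mB)).
    apply/measurable_EFinP.
    by apply: measurable_funTS; exact: measurable_normal_pdf.
  - by move=> z _; rewrite patchE; case: ifP => // _;
      rewrite lee_fin normal_pdf_ge0.
  - by rewrite lee_fin normal_pdf_ge0.
  apply: eq_integral => z _; rewrite patchE fE -EFinM mulrAC -normal_pdfM//.
  by rewrite indicE; case: (z \in B); rewrite ?mulr1 ?mulr0 ?mul0e.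
(* With [x] integrated first, the second factor in [fE] has total mass 1 and only the density of the
   sum remains. *)
rewrite fubini_tonelli// /normal_prob [RHS]integral_mkcond.
apply: eq_integral => z _.
under eq_integral do rewrite fE.
rewrite ge0_integralZl//; last 3 first.
- by apply/measurable_EFinP; exact: measurable_normal_pdf.
- by move=> x _; rewrite lee_fin normal_pdf_ge0.
- by rewrite lee_fin mulr_ge0 ?normal_pdf_ge0.
rewrite integral_normal_pdf mule1 patchE indicE.
by case: (z \in B); rewrite ?mulr1 ?mulr0.
Qed.
End convolution.

(** * Hölder's inequality and its equality case for finite sums *)

Section duality.
Variables (R : realType) (d : nat).
Implicit Types (v w : 'I_d -> R) (p q : \bar R).

Lemma dotpC v w : dotp v w = dotp w v.
Proof. by apply: eq_bigr => i _; rewrite mulrC. Qed.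

Lemma dotpB w x y : dotp w (fun k => x k - y k) = dotp w x - dotp w y.
Proof. by rewrite /dotp -sumrB; apply: eq_bigr => i _; rewrite mulrBr. Qed.

Lemma dotpZ w (a : R) x : dotp w (fun k => a * x k) = a * dotp w x.
Proof. by rewrite /dotp mulr_sumr; apply: eq_bigr => i _; rewrite mulrCA. Qed.

Lemma lpnorm1 v : lpnorm 1%E v = \sum_(i < d) `|v i|.
Proof.
rewrite /lpnorm /= invr1 powRr1; last by apply: sumr_ge0 => i _; exact: powR_ge0.
by apply: eq_bigr => i _; rewrite powRr1.
Qed.

Lemma lpnorm_ge0 p v : 0 <= lpnorm p v.
Proof.
case: p => [r| |]//=; first exact: powR_ge0.
by elim/big_ind : _ => // x y x0 y0; rewrite le_max x0.
Qed.

Lemma lpnorm_powR (r : R) v : r != 0 ->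
  lpnorm r%:E v `^ r = \sum_(i < d) `|v i| `^ r.
Proof.
move=> r0; rewrite /= -powRrM mulVf// powRr1//.
by apply: sumr_ge0 => i _; exact: powR_ge0.
Qed.

Lemma lpnorm_eq0 (r : R) v : 0 < r -> lpnorm r%:E v = 0 -> forall i, v i = 0.
Proof.
move=> r0 v0 i; have /esym/eqP := @lpnorm_powR r v (lt0r_neq0 r0).
rewrite v0 powR0 ?lt0r_neq0// psumr_eq0; last by move=> j _; exact: powR_ge0.
move=> /allP/(_ i (mem_index_enum i))/eqP/powR_eq0_eq0/eqP.
by rewrite normr_eq0 => /eqP.
Qed.

Lemma lpnormZ p v (a : R) : (1 <= p)%E -> 0 <= a ->
  lpnorm p (fun i => a * v i) = a * lpnorm p v.
Proof.
case: p => [r| |]//=; rewrite ?lee_fin => r1 a0.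
  have r0 : 0 < r by exact: lt_le_trans r1.
  under eq_bigr do rewrite normrM powRM// (ger0_norm a0).
  rewrite -mulr_sumr powRM ?powR_ge0//; last first.
    by apply: sumr_ge0 => i _; exact: powR_ge0.
  by rewrite -powRrM mulfV ?gt_eqF// powRr1.
elim/big_rec2 : _ => [|i y x _ ->]; first by rewrite mulr0.
by rewrite normrM (ger0_norm a0) maxr_pMr.
Qed.

Lemma sum_powR_normalized (r : R) v : 0 < r -> lpnorm r%:E v != 0 ->
  \sum_(i < d) (`|v i| / lpnorm r%:E v) `^ r = 1.
Proof.
move=> r0 v0; have vgt0 : 0 < lpnorm r%:E v by rewrite lt0r v0 lpnorm_ge0.
have vr0 : lpnorm r%:E v `^ r != 0 by rewrite lt0r_neq0// powR_gt0.
rewrite -[RHS](divff vr0) [X in X / _]lpnorm_powR ?lt0r_neq0// mulr_suml.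
apply: eq_bigr => i _; rewrite powRM ?invr_ge0 ?lpnorm_ge0//; congr (_ * _).
by rewrite -powR_inv1 ?ltW// -powRrM mulN1r powRN.
Qed.

Lemma le_lpnormy v i : `|v i| <= lpnorm +oo%E v.
Proof. by rewrite /lpnorm (bigD1 i)//= le_max lexx. Qed.

Lemma dotp_le_1y v w : dotp w v <= lpnorm 1%E w * lpnorm +oo%E v.
Proof.
rewrite lpnorm1 mulr_suml; apply: ler_sum => i _.
rewrite (le_trans (ler_norm _))// normrM ler_wpM2l//; exact: le_lpnormy.
Qed.

Lemma dotp_le_normalized (r s a b : R) v w :
  0 < r -> 0 < s -> r^-1 + s^-1 = 1 -> 0 < a -> 0 < b ->
  \sum_(i < d) (`|w i| / a) `^ s = 1 -> \sum_(i < d) (`|v i| / b) `^ r = 1 ->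
  dotp w v <= a * b.
Proof.
move=> r0 s0 rs a0 b0 wa vb.
have ab0 : 0 < a * b by exact: mulr_gt0.
rewrite -[leRHS]mul1r -ler_pdivrMr// /dotp mulr_suml.
(* Since [1 = s^-1 + r^-1] and both normalized sums equal 1, the bound splits over the coordinates,
   where it is Young's inequality. *)
have -> : 1 = \sum_(i < d) ((`|w i| / a) `^ s / s + (`|v i| / b) `^ r / r).
  by rewrite big_split/= -!mulr_suml wa vb !mul1r addrC.
apply: ler_sum => i _.
apply: (@le_trans _ _ ((`|w i| / a) * (`|v i| / b))).
  rewrite mulrACA -invfM -normrM; apply: ler_wpM2r; last exact: ler_norm.
  by rewrite invr_ge0 ltW.
have sr : s^-1 + r^-1 = 1 by rewrite addrC.
by apply: conjugate_powR => //; rewrite divr_ge0// ltW.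
Qed.

(** For finite exponents above 1, normalizing both vectors reduces to [dotp_le_normalized]; a vector
    of norm zero cannot be normalized, but it is the zero vector and both sides vanish. *)
Lemma dotp_le_lpnorm p q v w : dual_exponent p q ->
  dotp w v <= lpnorm q w * lpnorm p v.
Proof.
case=> [[-> ->]|[[-> ->]|[r [s [-> [-> [r1 [s1 rs]]]]]]]].
- by rewrite dotpC mulrC; exact: dotp_le_1y.
- exact: dotp_le_1y.
have r0 : 0 < r by exact: lt_trans r1.
have s0 : 0 < s by exact: lt_trans s1.
have [a0|a0] := eqVneq (lpnorm s%:E w) 0.
  rewrite a0 mul0r /dotp big1// => i _.
  by rewrite (@lpnorm_eq0 _ _ s0 a0) mul0r.
have [b0|b0] := eqVneq (lpnorm r%:E v) 0.
  rewrite b0 mulr0 /dotp big1// => i _.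
  by rewrite (@lpnorm_eq0 _ _ r0 b0) mulr0.
have agt0 : 0 < lpnorm s%:E w by rewrite lt0r a0 lpnorm_ge0.
have bgt0 : 0 < lpnorm r%:E v by rewrite lt0r b0 lpnorm_ge0.
exact: (dotp_le_normalized r s _ _ v w r0 s0 rs agt0 bgt0
  (sum_powR_normalized _ _ s0 a0) (sum_powR_normalized _ _ r0 b0)).
Qed.

(** The extremal vectors carry the signs of [w]: for [p = 1] a single signed unit at a coordinate
    where [w] is largest in absolute value, for [p = +oo] the full sign vector, and in between signs
    weighted by the power [s - 1] of the normalized coordinates. *)
Lemma dotp_attain p q w : dual_exponent p q ->
  exists2 v, lpnorm p v <= 1 & dotp w v = lpnorm q w.
Proof.
case=> [[-> ->]|[[-> ->]|[r [s [-> [-> [r1 [s1 rs]]]]]]]].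
- have [->|w0] := eqVneq (lpnorm +oo%E w) 0.
    exists (fun=> 0); last by rewrite /dotp big1// => i _; rewrite mulr0.
    by rewrite lpnorm1 big1// => i _; rewrite normr0.
  have [k wk] : exists k, lpnorm +oo%E w = `|w k|.
    move: w0; rewrite /lpnorm.
    elim/big_ind : _ => [|x y IHx IHy|i _ _]; rewrite ?eqxx//; last by exists i.
    by rewrite /Num.max; case: ifP.
  exists (fun i => if i == k then Num.sg (w k) else 0).
    rewrite lpnorm1 (bigD1 k)//= eqxx big1 ?addr0.
      by rewrite normr_sg; case: (_ != 0).
    by move=> i /negbTE ->; rewrite normr0.
  rewrite wk /dotp (bigD1 k)//= eqxx big1 ?addr0; last first.
    by move=> i /negbTE ->; rewrite mulr0.
  by rewrite normrEsg mulrC.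
- exists (fun i => Num.sg (w i)).
    rewrite /lpnorm; elim/big_ind : _ => // [x y x1 y1|i _].
      by rewrite ge_max x1.
    by rewrite normr_sg; case: (_ != 0).
  by rewrite lpnorm1; apply: eq_bigr => i _; rewrite normrEsg mulrC.
have r0 : 0 < r by exact: lt_trans r1.
have s0 : 0 < s by exact: lt_trans s1.
set a := lpnorm s%:E w.
have [a0|a0] := eqVneq a 0.
  exists (fun=> 0); last first.
    by rewrite /dotp a0 big1// => i _; rewrite mulr0.
  rewrite /lpnorm big1 ?powR0 ?invr_eq0 ?gt_eqF// => i _.
  by rewrite normr0 powR0 ?gt_eqF.
have agt0 : 0 < a by rewrite lt0r a0 lpnorm_ge0.
(* This identity turns the [r]-th powers of the extremal vector into the normalized [s]-th powers of
   [w], whose sum is 1. *)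
have rsE : (s - 1) * r = s.
  have -> : r = (1 - s^-1)^-1 by rewrite -rs addrK invrK.
  by field; rewrite lt0r_neq0//= subr_eq0 gt_eqF.
have sgE i : `|Num.sg (w i) * (`|w i| / a) `^ (s - 1)| `^ r =
             (`|w i| / a) `^ s.
  have [->|wi0] := eqVneq (w i) 0.
    by rewrite sgr0 mul0r !normr0 mul0r !powR0// gt_eqF.
  rewrite normrM normr_sg wi0 mul1r ger0_norm ?powR_ge0//.
  by rewrite -powRrM rsE.
exists (fun i => Num.sg (w i) * (`|w i| / a) `^ (s - 1)).
  rewrite /lpnorm; under eq_bigr do rewrite sgE.
  by rewrite (@sum_powR_normalized s w s0 a0) powR1.
transitivity (a * \sum_(i < d) (`|w i| / a) `^ s); last first.
  by rewrite (@sum_powR_normalized s w s0 a0) mulr1.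
rewrite mulr_sumr; apply: eq_bigr => i _; rewrite mulrA [w i * _]mulrC -normrEsg.
have wa0 : 0 <= `|w i| / a by rewrite divr_ge0 ?lpnorm_ge0.
by rewrite -[in RHS](mulr_powRB1 wa0 s0) mulrA [a * _]mulrC divfK.
Qed.
End duality.

(** * Normal law of a linear form in independent normal coordinates *)

Lemma eq_normal_prob_sqr (R : realType) (m s s' : R) (B : set R) :
  s != 0 -> s' != 0 -> s ^+ 2 = s' ^+ 2 ->
  normal_prob m s B = normal_prob m s' B.
Proof.
move=> s0 s'0 ss.
rewrite /normal_prob (normal_pdfE m s0) (normal_pdfE m s'0).
by rewrite /normal_peak /normal_fun ss.
Qed.

Section law.
Local Open Scope ereal_scope.
Context {dT : measure_display} {T : measurableType dT} {R : realType}.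
Variable P : probability T R.

(** The product formula on rectangles determines the joint law of [Z] and [W] on [E]: it is [c]
    times a product of normal laws, so the sum follows the convolution. Working on an event [E] of
    mass [c] covers both the class label and the boxes of the later induction. *)
Lemma normal_lawD (E : set T) (Z W : T -> R) (c m1 m2 s1 s2 s : R) :
  measurable E -> measurable_fun setT Z -> measurable_fun setT W ->
  (0 <= c)%R -> s1 != 0%R -> s2 != 0%R -> s != 0%R ->
  (s ^+ 2 = s1 ^+ 2 + s2 ^+ 2)%R ->
  (forall A B, measurable A -> measurable B ->
    P (E `&` [set t | A (Z t) /\ B (W t)]) =
    c%:E * (normal_prob m1 s1 A * normal_prob m2 s2 B)) ->
  forall B, measurable B ->
    P (E `&` [set t | B (Z t + W t)%R]) = c%:E * normal_prob (m1 + m2) s B.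
Proof.
move=> mE mZ mW c0 s10 s20 s0 ss hZW B mB.
have mS : measurable (E `&` [set t | B (Z t + W t)%R]).
  apply: measurableI => //; rewrite -[X in measurable X]setTI.
  by apply: (measurable_funD mZ mW).
(* If [c = 0] no normalization is possible, but taking both test sets to be [setT] shows that [E] is
   null. *)
have [c00|cn0] := eqVneq c 0%R.
  rewrite c00 mul0e; apply/eqP; rewrite eq_le measure_ge0 andbT.
  have <- : P (E `&` [set t | setT (Z t) /\ setT (W t)]) = 0.
    by rewrite hZW// c00 mul0e.
  apply: le_measure; rewrite ?inE//; last by move=> t [].
  by apply: measurableI => //; rewrite (_ : [set _ | _] = setT)//; apply/seteqP.
have cV0 : (0 <= c^-1)%R by rewrite invr_ge0.
pose R' := measurableTypeR R.
have mZW : measurable_fun setT (fun t => (Z t, W t) : R' * R').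
  exact: measurable_fun_pair.
(* The joint law of [Z] and [W] restricted to [E], rescaled by [c^-1]; it agrees with the product
   measure on rectangles, hence everywhere. *)
pose m' : {measure set (R' * R') -> \bar R} :=
  mscale (NngNum cV0) (pushforward_measure (mrestr P mE) mZW).
have m'E A : m' A = (c^-1)%:E * P (E `&` [set t | A (Z t, W t)]).
  by rewrite /m' /mscale/= /pushforward /mrestr setIC.
have m'X A C : measurable A -> measurable C ->
    m' (A `*` C) = normal_prob m1 s1 A * normal_prob m2 s2 C.
  by move=> mA mC; rewrite m'E hZW// muleA -EFinM mulVf// mul1e.
rewrite -(@normal_prob_convolution R m1 m2 s1 s2 s)//.
have prodE := @product_measure_unique _ _ _ _ _
  (normal_prob m1 s1) (normal_prob m2 s2) m' m'X.
have madd : measurable_fun setT (fun z : R * R => z.1 + z.2)%R.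
  by apply: measurable_funD.
have mD : measurable ((fun z : R * R => z.1 + z.2)%R @^-1` B).
  by rewrite -[X in measurable X]setTI; exact: madd.
by rewrite (prodE _ mD) m'E muleA -EFinM mulfV// mul1e.
Qed.

Context {d : nat}.
Variables (X : T -> 'I_d -> R) (E0 : set T) (m : 'I_d -> R) (sigma c : R).
Hypothesis mX : forall k, measurable_fun setT (fun t => X t k).
Hypothesis mE0 : measurable E0.
Hypothesis sigma0 : sigma != 0%R.
Hypothesis c0 : (0 <= c)%R.
Hypothesis XE : forall A : 'I_d -> set R, (forall k, measurable (A k)) ->
  P (E0 `&` [set t | forall k, A k (X t k)]) =
  c%:E * \prod_(k < d) normal_prob (m k) sigma (A k).

Lemma measurable_lincomb (a : 'I_d -> R) (l : seq 'I_d) :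
  measurable_fun setT (fun t => \sum_(k <- l) a k * X t k)%R.
Proof. by apply: measurable_sum => k; exact: measurable_funM. Qed.

Lemma measurable_forall_notin (A : 'I_d -> set R) (l : seq 'I_d) :
  (forall k, measurable (A k)) ->
  measurable [set t | forall k, k \notin l -> A k (X t k)].
Proof.
move=> mA.
rewrite (_ : [set _ | _] = \bigcap_(k in [set k | k \notin l])
    ((fun t => X t k) @^-1` A k)); last by [].
apply: fin_bigcap_measurable => [|k _].
  exact: (finite_finpred [pred k | k \notin l]).
rewrite -[X in measurable X]setTI; exact: mX.
Qed.

(* The boxes over the coordinates outside the sum make the induction go
   through: they provide the independence needed to add the next coordinate.
   The pivot [k0] keeps the partial sums nondegenerate, because [normal_prob _ 0]
   is not a Dirac mass. *)
Lemma normal_law_sum_box (a : 'I_d -> R) (k0 : 'I_d) (s : seq 'I_d) :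
  a k0 != 0%R -> uniq (rcons s k0) ->
  forall (tau : R), tau != 0%R ->
  (tau ^+ 2 = \sum_(k <- rcons s k0) (a k * sigma) ^+ 2)%R ->
  forall (A : 'I_d -> set R) (B : set R),
  (forall k, measurable (A k)) -> measurable B ->
  P (E0 `&` [set t | B (\sum_(k <- rcons s k0) a k * X t k)%R /\
                     forall k, k \notin rcons s k0 -> A k (X t k)]) =
  c%:E * (normal_prob (\sum_(k <- rcons s k0) a k * m k)%R tau B *
          \prod_(k < d | k \notin rcons s k0) normal_prob (m k) sigma (A k)).
Proof.
move=> ak0; elim: s => [_|k s IH /= /andP[ks us]] tau tau0 tauE A B mA mB.
  rewrite /= !big_seq1 in tauE *.
  (* With only the pivot in the sum, the condition on [a k0 * X t k0] is itself a box condition on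
     coordinate [k0], so [XE] applies. *)
  pose A' j := if j == k0 then (fun x : R => a k0 * x + 0)%R @^-1` B else A j.
  have mA' j : measurable (A' j).
    by rewrite /A'; case: ifP => // _; exact: measurable_affine_preimage.
  have := XE A' mA'.
  have A'k0 : A' k0 = (fun x : R => a k0 * x + 0)%R @^-1` B by rewrite /A' eqxx.
  rewrite (bigD1 k0)//= A'k0 normal_prob_affine// addr0.
  rewrite (@eq_normal_prob_sqr _ _ (a k0 * sigma) tau) ?mulf_neq0//.
  rewrite (eq_bigr (fun j => normal_prob (m j) sigma (A j))); last first.
    by move=> j /negbTE jk; rewrite /A' jk.
  rewrite (eq_bigl (fun j => j \notin [:: k0])); last first.
    by move=> j; rewrite mem_seq1.
  move=> <-; congr (P (_ `&` _)); apply/seteqP; split => t /=.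
    move=> [Bt At] j; rewrite /A'; case: eqP => [->|/eqP jk].
      by move: Bt; rewrite big_seq1 /= addr0.
    by apply: At; rewrite mem_seq1.
  move=> At; split; first by have := At k0; rewrite A'k0 big_seq1 /= addr0.
  by move=> j; rewrite mem_seq1 => jk; have := At j; rewrite /A' (negbTE jk).
set l := rcons s k0 in ks us IH tauE *.
have notinE j : (j \notin k :: l) = (j \notin l) && (j != k).
  by rewrite inE negb_or andbC.
(* Coordinate [k] lies outside the shorter sum, so the induction hypothesis leaves its box free to
   be chosen as [C]. *)
pose upd C j := if j == k then C else A j.
have mupd C : measurable C -> forall j, measurable (upd C j).
  by move=> mC j; rewrite /upd; case: ifP.
have setE (C : set R) (Q : T -> Prop) :
    [set t | Q t /\ forall j, j \notin l -> upd C j (X t j)] =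
    [set t | forall j, j \notin k :: l -> A j (X t j)] `&`
    [set t | Q t /\ C (X t k)].
  apply/seteqP; split => t /=.
    move=> [Qt At]; split => [j|].
      by rewrite notinE => /andP[jl jk]; have := At j jl; rewrite /upd (negbTE jk).
    by split => //; have := At k ks; rewrite /upd eqxx.
  move=> [At [Qt Ct]]; split => // j jl; rewrite /upd; case: eqP => [->//|/eqP jk].
  by apply: At; rewrite notinE jl.
have prodE C : \prod_(j < d | j \notin l) normal_prob (m j) sigma (upd C j) =
    normal_prob (m k) sigma C *
    \prod_(j < d | j \notin k :: l) normal_prob (m j) sigma (A j).
  rewrite (bigD1 k)//=; congr (_ * _); first by rewrite /upd eqxx.
  rewrite (eq_bigl _ _ notinE); apply: eq_bigr => j /andP[_ /negbTE jk].
  by rewrite /upd jk.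
(* A zero coefficient would give a degenerate summand; the term is dropped and coordinate [k]
   released through the box [setT], of probability 1. *)
have [ak|ak] := eqVneq (a k) 0%R.
  rewrite big_cons ak mul0r add0r.
  have := IH us tau tau0 _ (upd setT) B (mupd _ measurableT) mB.
  rewrite prodE probability_setT mul1e => <-.
    congr (P (_ `&` _)); rewrite (setE _ (fun t => B _)).
    by apply/seteqP; split => t /=; rewrite big_cons ak mul0r add0r; tauto.
  by rewrite tauE big_cons ak mul0r expr0n/= add0r.
(* The standard deviation of the shorter sum, positive because [l] contains the pivot [k0]. *)
pose rho := Num.sqrt (\sum_(j <- l) (a j * sigma) ^+ 2)%R.
have sum_gt0 : (0 < \sum_(j <- l) (a j * sigma) ^+ 2)%R.
  rewrite /l big_rcons ltr_wpDl ?sumr_ge0 => // [j _|]; rewrite ?sqr_ge0//.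
  by rewrite exprn_even_gt0//= mulf_neq0.
have rho0 : rho != 0%R by rewrite gt_eqF// sqrtr_gt0.
have rhoE : (rho ^+ 2 = \sum_(j <- l) (a j * sigma) ^+ 2)%R.
  by rewrite sqr_sqrtr// ltW.
set q := \prod_(j < d | j \notin k :: l) normal_prob (m j) sigma (A j).
have qfin : q \is a fin_num.
  apply: prode_fin_num => j _.
  exact: (fin_num_measure (normal_prob (m j) sigma) _ (mA j)).
have q0 : 0 <= q by apply: prode_ge0 => j _.
(* The remaining boxes are absorbed into the conditioning event, and their probability [q] into the
   constant. *)
pose E := E0 `&` [set t | forall j, j \notin k :: l -> A j (X t j)].
have mE : measurable E by apply: measurableI => //; exact: measurable_forall_notin.
have -> : c%:E * (normal_prob (\sum_(j <- k :: l) a j * m j)%R tau B * q) =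
    (c * fine q)%:E * normal_prob (\sum_(j <- l) a j * m j + a k * m k)%R tau B.
  by rewrite EFinM fineK// big_cons addrC -muleA [q * _]muleC.
rewrite -(@normal_lawD E (fun t => \sum_(j <- l) a j * X t j)%R
  (fun t => a k * X t k)%R (c * fine q) _ _ rho (a k * sigma) tau)//.
- rewrite /E -setIA; congr (P (_ `&` _)); apply/seteqP; split => t /=.
    by rewrite big_cons addrC => -[].
  by rewrite big_cons addrC => -[].
- exact: measurable_lincomb.
- exact: measurable_funM.
- by rewrite mulr_ge0// fine_ge0.
- by rewrite mulf_neq0.
- by rewrite tauE big_cons rhoE addrC.
(* The rectangle formula for the shorter sum and the new term is the induction hypothesis with the
   box at [k] taken to be the preimage of [C] under scaling by [a k]. *)
move=> B1 C mB1 mC.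
pose C' := (fun x : R => a k * x + 0)%R @^-1` C.
have mC' : measurable C' by exact: measurable_affine_preimage.
have := IH us rho rho0 rhoE (upd C') B1 (mupd _ mC') mB1.
rewrite prodE normal_prob_affine// addr0 (setE _ (fun t => B1 _)) setIA -/q.
have -> : (c * fine q)%:E * (normal_prob (\sum_(j <- l) a j * m j)%R rho B1 *
    normal_prob (a k * m k) (a k * sigma) C) =
    c%:E * (normal_prob (\sum_(j <- l) a j * m j)%R rho B1 *
    (normal_prob (a k * m k) (a k * sigma) C * q)).
  by rewrite EFinM fineK// -muleA [q * _]muleC -[(_ * _) * q]muleA.
move=> <-.
congr (P (_ `&` _)); apply/seteqP; split => t /=; rewrite /C' /= addr0; tauto.
Qed.

(** The coordinates are reordered so that one with nonzero coefficient comes last and serves as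
    pivot; no coordinate is then left outside the sum. *)
Lemma normal_law_dotp (a : 'I_d -> R) (tau : R) : (exists k, a k != 0%R) ->
  tau != 0%R -> (tau ^+ 2 = \sum_(k < d) (a k * sigma) ^+ 2)%R ->
  forall B, measurable B ->
  P (E0 `&` [set t | B (dotp a (X t))]) = c%:E * normal_prob (dotp a m) tau B.
Proof.
move=> [k0 ak0] tau0 tauE B mB.
pose s := rem k0 (index_enum 'I_d).
have sE : perm_eq (index_enum 'I_d) (rcons s k0).
  by rewrite perm_sym perm_rcons perm_sym perm_to_rem// mem_index_enum.
have us : uniq (rcons s k0) by rewrite -(perm_uniq sE) index_enum_uniq.
have := @normal_law_sum_box a k0 s ak0 us tau tau0 _ (fun=> setT) B
  (fun=> measurableT) mB.
rewrite -!(perm_big _ sE)/= => /(_ tauE).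
rewrite [X in _ * (_ * X)]big1 ?mule1; last first.
  by move=> k _; exact: probability_setT.
rewrite /dotp => <-; congr (P (_ `&` _)); apply/seteqP; split => t /=.
  by rewrite -!(perm_big _ sE).
by rewrite -!(perm_big _ sE) => -[].
Qed.
End law.

(** * Adversarial perturbations of a linear classifier, and normal half-lines *)

Section adversary.
Variables (R : realType) (d : nat).
Implicit Types (x w : 'I_d -> R) (p q : \bar R).

Lemma lpnorm_opp p x : lpnorm p (fun k => - x k) = lpnorm p x.
Proof.
case: p => [r| |]; rewrite /lpnorm; last by [].
  under eq_bigr do rewrite normrN.
  by [].
by apply: eq_bigr => i _; rewrite normrN.
Qed.

Lemma dotpNl w x : dotp (fun k => - w k) x = - dotp w x.
Proof. by rewrite /dotp -sumrN; apply: eq_bigr => i _; rewrite mulNr. Qed.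

Lemma lpnorm_distC p x w :
  lpnorm p (fun k => x k - w k) = lpnorm p (fun k => w k - x k).
Proof. by rewrite -lpnorm_opp; congr lpnorm; apply/funext => k; rewrite opprB. Qed.

Lemma dotpD w x y : dotp w (fun k => x k + y k) = dotp w x + dotp w y.
Proof. by rewrite /dotp -big_split; apply: eq_bigr => i _; rewrite mulrDr. Qed.

(** Hölder bounds the change of score by [eps * lpnorm q w], and the extremal vector attains it. One
    inequality is strict and the other is not because a score of exactly 0 is assigned to class
    -. *)
Lemma adversarialP p q w b eps x : (1 <= p)%E -> dual_exponent p q -> 0 <= eps ->
  (exists x', lpnorm p (fun k => x k - x' k) <= eps /\
              classify w b x' != classify w b x) <->
  if classify w b x then dotp w x + b <= eps * lpnorm q w
  else - (eps * lpnorm q w) < dotp w x + b.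
Proof.
move=> p1 pq eps0.
have [v v1 wv] := dotp_attain R d p q w pq.
have veps : lpnorm p (fun k => eps * v k) <= eps by rewrite lpnormZ// ler_piMr.
have dist x' : lpnorm p (fun k => x k - x' k) <= eps ->
    dotp w x - dotp w x' <= eps * lpnorm q w /\
    dotp w x' - dotp w x <= eps * lpnorm q w.
  move=> xx'; have bnd (u : 'I_d -> R) : lpnorm p u <= eps ->
      dotp w u <= eps * lpnorm q w.
    move=> u1; apply: le_trans (dotp_le_lpnorm _ _ _ _ u w pq) _.
    by rewrite mulrC ler_wpM2r// lpnorm_ge0.
  by rewrite -!dotpB; split; apply: bnd => //; rewrite lpnorm_distC.
split=> [[x' [xx' cl]]|].
  have [h1 h2] := dist _ xx'; move: cl; rewrite /classify.
  by case: (ltP 0 (dotp w x' + b)); case: (ltP 0 (dotp w x + b)) => //= *; lra.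
(* The witness moves by [eps * v] against the current class: down from class +, up from class -. *)
case: ifPn => cl wx.
  exists (fun k => x k - eps * v k); split.
    rewrite (_ : (fun k => _) = (fun k => eps * v k))//.
    by apply/funext => k; rewrite subKr.
  rewrite /classify dotpB dotpZ wv eqb_id -leNgt; lra.
exists (fun k => x k + eps * v k); split.
  rewrite lpnorm_distC (_ : (fun k => _) = (fun k => eps * v k))//.
  by apply/funext => k; rewrite addrAC subrr add0r.
rewrite /classify dotpD dotpZ wv eqbF_neg negbK; lra.
Qed.

Lemma sqr_lpnorm2 w : lpnorm 2%:E w ^+ 2 = \sum_(k < d) w k ^+ 2.
Proof.
rewrite -powR_mulrn ?lpnorm_ge0// lpnorm_powR ?pnatr_eq0//.
by apply: eq_bigr => k _; rewrite powR_mulrn// -normrX ger0_norm ?sqr_ge0.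
Qed.

Lemma lpnorm2_gt0 w : w <> (fun=> 0) -> 0 < lpnorm 2%:E w.
Proof.
move=> w0; rewrite lt0r lpnorm_ge0 andbT; apply/eqP => w20; apply: w0.
by apply/funext => k; apply: (@lpnorm_eq0 _ _ 2 w) => //; rewrite ltr0n.
Qed.

Lemma normal_prob_Phi (m s u : R) : 0 < s ->
  normal_prob m s `]-oo, u] = (Phi ((u - m) / s))%:E.
Proof.
move=> s0; rewrite /Phi fineK; last exact: fin_num_measure.
have sV0 : s^-1 != 0 by rewrite invr_eq0 gt_eqF.
have sn0 : s != 0 by rewrite gt_eqF.
have := @normal_prob_affine R s^-1 (- (m / s)) m s `]-oo, (u - m) / s]
  sV0 sn0 (measurable_itv _).
have -> : s^-1 * m - m / s = 0 by rewrite mulrC subrr.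
rewrite (mulVf sn0) => <-.
congr normal_prob; apply/seteqP; split => x /=; rewrite !in_itv/= => h.
  by rewrite [s^-1 * x]mulrC -mulrBl ler_pM2r ?invr_gt0// lerB.
by move: h; rewrite [s^-1 * x]mulrC -mulrBl ler_pM2r ?invr_gt0// lerD2r.
Qed.

Lemma normal_prob_Phi_lt (m s u : R) : 0 < s ->
  normal_prob m s `]-oo, u[ = (Phi ((u - m) / s))%:E.
Proof.
move=> s0; rewrite -normal_prob_Phi// /normal_prob integral_itv_bndo_bndc//.
by apply/measurable_EFinP; apply: measurable_funTS; exact: measurable_normal_pdf.
Qed.
End adversary.

(** * The probability of a correctly classified point with an adversarial example *)

Theorem theorem3 (R : realType) (d : nat) (p q : \bar R)
  (hp1 : (1 <= p)%E) (hpq : dual_exponent p q)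
  (mu : bool -> 'I_d -> R) (sigma : R) (hsigma : 0 < sigma)
  (dT : measure_display) (T : measurableType dT) (P : probability T R)
  (X : T -> 'I_d -> R) (Y : T -> bool)
  (hX : forall k : 'I_d, measurable_fun setT (fun t => X t k))
  (hY : measurable (Y @^-1` [set true]))
  (hXY : forall (i : bool) (A : 'I_d -> set R), (forall k, measurable (A k)) ->
     P [set t | Y t = i /\ forall k, A k (X t k)] =
       ((2^-1)%:E * \prod_(k < d) normal_prob (mu i k) sigma (A k))%E)
  (w : 'I_d -> R) (hw : w <> (fun _ => 0)) (b : R)
  (eps : R) (heps : 0 < eps) :
  let muv := fun k => (mu true k - mu false k) / 2 in
  let mubar := fun k => (mu true k + mu false k) / 2 in
  let b' := dotp w mubar + b in
  let p_m := fine (P [set t | classify w b (X t) != Y t]) in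
  let p_adv := P [set t | classify w b (X t) = Y t /\
                   exists x' : 'I_d -> R,
                     lpnorm p (fun k => X t k - x' k) <= eps /\
                     classify w b x' != classify w b (X t)] in
  p_adv = (1 - p_m - 2^-1 *
     (Phi ((dotp w muv + b') / (lpnorm 2%:E w * sigma)
             - lpnorm q w / lpnorm 2%:E w * (eps / sigma))
    + Phi ((dotp w muv - b') / (lpnorm 2%:E w * sigma)
             - lpnorm q w / lpnorm 2%:E w * (eps / sigma))))%:E.
Proof.
move=> muv mubar b' p_m p_adv.
set L2 := lpnorm 2%:E w; set L := lpnorm q w.
have L20 : 0 < L2 := lpnorm2_gt0 _ _ w hw.
have tau0 : 0 < L2 * sigma := mulr_gt0 L20 hsigma.
pose E i := Y @^-1` [set i].
have mE i : measurable (E i).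
  case: i => //; rewrite (_ : E false = ~` E true); first exact: measurableC.
  by apply/seteqP; split => t; rewrite /E /=; case: (Y t).
(* Kept general in [v], since it is used for [w] on class - and for the opposite of [w] on class
   +. *)
have law i (v : 'I_d -> R) B : v <> (fun=> 0) -> measurable B ->
    P (E i `&` [set t | B (dotp v (X t))]) =
    ((2^-1)%:E * normal_prob (dotp v (mu i)) (lpnorm 2%:E v * sigma) B)%E.
  move=> v0 mB; apply: (normal_law_dotp P X (E i) (mu i) sigma 2^-1) => //.
  - by rewrite gt_eqF.
  - by move=> A mA; rewrite -hXY.
  - apply: contrapT => /forallNP v0'; apply: v0; apply/funext => k.
    by apply/eqP; apply: contrapT => /negP/v0'.
  - exact: (lt0r_neq0 (mulr_gt0 (lpnorm2_gt0 _ _ v v0) hsigma)).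
  - rewrite exprMn sqr_lpnorm2 mulr_suml.
    by apply: eq_bigr => k _; rewrite exprMn.
pose robust i := if i then [set t | eps * L < dotp w (X t) + b]
                 else [set t | dotp w (X t) + b <= - (eps * L)].
have muE : dotp w (mu true) = dotp w muv + dotp w mubar /\
           dotp w (mu false) = dotp w mubar - dotp w muv.
  rewrite -dotpD -dotpB; split; apply: eq_bigr => k _;
    by rewrite /muv /mubar; congr (_ * _); field.
have robust_true : P (E true `&` robust true) = (2^-1 *
    Phi ((dotp w muv + b') / (L2 * sigma) - L / L2 * (eps / sigma)))%:E.
  have nw : (fun k => - w k) <> (fun=> 0).
    move=> nw; apply: hw; apply/funext => j.
    have /= := congr1 (fun f : 'I_d -> R => f j) nw.
    by move/eqP; rewrite oppr_eq0 => /eqP.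
  (* Negating [w] turns the upper half-line into a lower one, so that [Phi] applies without its
     reflection formula. The half-line is open here and closed for class -. *)
  rewrite (_ : robust true = [set t |
      `]-oo, (b - eps * L)[%classic (dotp (fun k => - w k) (X t))]); last first.
    by apply/seteqP; split => t /=; rewrite in_itv/= dotpNl => h; lra.
  rewrite law// lpnorm_opp normal_prob_Phi_lt// -EFinM dotpNl muE.1 /b'.
  congr (_ * Phi _)%:E; rewrite -/L2; field.
  by rewrite !gt_eqF.
have robust_false : P (E false `&` robust false) = (2^-1 *
    Phi ((dotp w muv - b') / (L2 * sigma) - L / L2 * (eps / sigma)))%:E.
  rewrite (_ : robust false = [set t |
      `]-oo, (- (eps * L) - b)]%classic (dotp w (X t))]); last first.
    by apply/seteqP; split => t /=; rewrite in_itv/= => h; lra.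
  rewrite law// normal_prob_Phi// -EFinM muE.2 /b'.
  congr (_ * Phi _)%:E; rewrite -/L2; field.
  by rewrite !gt_eqF.
have mS (I : interval R) : measurable [set t | dotp w (X t) + b \in I].
  have mf : measurable_fun setT (fun t => dotp w (X t) + b).
    by apply: measurable_funD => //; exact: measurable_lincomb.
  rewrite -[X in measurable X]setTI; exact: (mf measurableT [set` I]).
have mR i : measurable (E i `&` robust i).
  apply: measurableI => //; case: i.
    rewrite (_ : robust true = [set t | dotp w (X t) + b \in `]eps * L, +oo[])//.
    by apply/seteqP; split => t /=; rewrite in_itv/= andbT.
  by rewrite (_ : robust false =
    [set t | dotp w (X t) + b \in `]-oo, - (eps * L)]]).
pose M := [set t | classify w b (X t) != Y t].
have mM : measurable M.
  rewrite (_ : M = (E true `&` [set t | dotp w (X t) + b \in `]-oo, 0]]) `|`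
                   (E false `&` [set t | dotp w (X t) + b \in `]0, +oo[])).
    by apply: measurableU; exact: measurableI.
  apply/seteqP; split => t; rewrite /M /E /classify /= !in_itv/= andbT leNgt.
    by case: (Y t); case: ltP => //= _ _; [left|right].
  by case: (Y t); case: ltP => //= _ [[]|[]].
have LE : 0 <= eps * L := mulr_ge0 (ltW heps) (lpnorm_ge0 _ _ q w).
(* Every outcome is misclassified, robustly correct, or adversarial. *)
have advE : [set t | classify w b (X t) = Y t /\
    exists x' : 'I_d -> R, lpnorm p (fun k => X t k - x' k) <= eps /\
      classify w b x' != classify w b (X t)] =
    ~` (M `|` (E true `&` robust true `|` E false `&` robust false)).
  apply/seteqP; split => t /=.
    move=> [cl /(adversarialP _ _ _ _ _ _ _ _ hp1 hpq (ltW heps))].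
    rewrite cl /M /E /= cl eqxx -/L.
    by case: (Y t) => h [//|[[//= _ rt]|[//= _ rt]]]; [move: rt|move: h];
      rewrite ltNge ?h ?rt.
  move=> /not_orP[/negP]; rewrite negbK => /eqP cl /not_orP[h1 h2].
  split => //; apply/(adversarialP _ _ _ _ _ _ _ _ hp1 hpq (ltW heps)).
  rewrite cl -/L; move: h1 h2; rewrite /E /=; case: (Y t) => h1 h2.
    by rewrite leNgt; apply/negP => h; apply: h1.
  by rewrite ltNge; apply/negP => h; apply: h2.
(* By [LE] the robust thresholds lie on the correct side of 0; this makes the robust event disjoint
   from [M]. *)
have robust_correct i t : robust i t -> classify w b (X t) = i.
  by rewrite /classify; case: i => /= h; [|apply/negbTE; rewrite -leNgt]; lra.
rewrite /p_adv advE probability_setC; last first.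
  by apply: measurableU => //; exact: measurableU.
have -> : P (M `|` (E true `&` robust true `|` E false `&` robust false)) =
    (P M + P (E true `&` robust true `|` E false `&` robust false))%E.
  apply: measureU => //; first exact: measurableU.
  rewrite -subset0 => t [] /negP Mt.
  by case=> -[Et /robust_correct rt]; apply: Mt; rewrite rt Et.
have -> : P (E true `&` robust true `|` E false `&` robust false) =
    (P (E true `&` robust true) + P (E false `&` robust false))%E.
  apply: measureU => //.
  by rewrite -subset0 => t [[+ _] [+ _]]; rewrite /E /= => ->.
rewrite robust_true robust_false /p_m -/M.
rewrite -(@fineK _ (P M)) ?fin_num_measure//.
rewrite -!EFinD; congr (_%:E); ring.
Qed.
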